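(* Let $\mathbb{SU}=\prod_{n=1}^\infty SU(n)$. For a comeager set of $G\in\mathcal{S}(\mathbb{SU})$ the following holds: for a comeager set of $K\in\mathcal{K}(G)$, $K$ has cardinality continuum and $K$ freely generates a free group in $G$ (i.e. for every $m$ and every pairwise distinct $k_1,\dots,k_m\in K$, no nonempty reduced word in $m$ variables evaluates to the identity at $(k_1,\dots,k_m)$), so $K$ freely generates a free group of rank continuum.
   Context: $\mathbb{SU}$ carries the product topology, metrized by $d(x,y)=\sum_n 2^{-n}d_n(x(n),y(n))$ where $d_n\le 1$ is a biinvariant metric on $SU(n)$. $\mathcal{S}(\mathbb{SU})$ is the set of nonempty compact subgroups of $\mathbb{SU}$ with the Hausdorff metric induced by $d$. For a topological space $X$, $\mathcal{K}(X)$ is the space of nonempty compact subsets of $X$ with the Vietoris topology (equivalently the Hausdorff metric). *)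

(* Defs.v *)
From HB Require Import structures.
From mathcomp Require Import all_boot all_order all_algebra.
From mathcomp Require Import spectral sesquilinear.
From mathcomp Require Import all_classical all_reals all_analysis.
From mathcomp Require Import complex.

Set Implicit Arguments.
Unset Strict Implicit.
Unset Printing Implicit Defensive.

Import Order.TTheory GRing.Theory Num.Theory.
Import numFieldNormedType.Exports.

Local Open Scope classical_set_scope.
Local Open Scope sesquilinear_scope.
Local Open Scope complex_scope.
Local Open Scope ring_scope.

Definition nowhere_dense (T : topologicalType) (A : set T) :=
  interior (closure A) = set0.

Definition meager (T : topologicalType) (A : set T) :=
  exists F : nat -> set T,
    (forall n, nowhere_dense (F n)) /\ A `<=` \bigcup_n F n.

Definition comeager (T : topologicalType) (A : set T) := meager (~` A).

Section Metric.
Variable R : realType.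

Definition is_metric (T : Type) (d : T -> T -> R) :=
  [/\ forall x y, d x y = 0 <-> x = y,
      forall x y, d x y = d y x &
      forall x y z, d x z <= d x y + d y z].

Definition metric_open (T : Type) (d : T -> T -> R) (A : set T) :=
  forall x, A x -> exists2 e, 0 < e & forall y, d x y < e -> A y.

Definition metrizes (T : topologicalType) (d : T -> T -> R) :=
  is_metric d /\ (forall A : set T, open A <-> metric_open d A).

Definition biinvariant (G : groupType) (d : G -> G -> R) :=
  forall z x y : G, d (z * x)%g (z * y)%g = d x y /\
                    d (x * z)%g (y * z)%g = d x y.

(* The set [T] with the topology of the open sets of [d]; this is a topology
   for an arbitrary function [d]. *)
Definition metrized (T : choiceType) (d : T -> T -> R) : Type := T.

Section MetrizedTopology.
Variables (T : choiceType) (d : T -> T -> R).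

Fact metric_openT : metric_open d setT.
Proof. by move=> x _; exists 1. Qed.

Fact metric_openI : setI_closed (metric_open d).
Proof.
move=> A B oA oB x [Ax Bx].
have [e e0 eA] := oA x Ax; have [f f0 fB] := oB x Bx.
exists (Order.min e f); first by rewrite lt_min e0 f0.
by move=> y; rewrite lt_min => /andP[? ?]; split; [exact: eA|exact: fB].
Qed.

Fact metric_open_bigU (I : Type) (f : I -> set T) :
  (forall i, metric_open d (f i)) -> metric_open d (\bigcup_i f i).
Proof.
move=> of_ x [i _ fx]; have [e e0 ef] := of_ i x fx.
by exists e => // y /ef fy; exists i.
Qed.

HB.instance Definition _ := Choice.on (metrized d).
HB.instance Definition _ := @isOpenTopological.Build (metrized d)
  (metric_open d) metric_openT metric_openI metric_open_bigU.
End MetrizedTopology.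

(* The suprema and infima are the real ones of the library (total, with junk
   values on unbounded sets); here [d] is bounded and the sets are nonempty. *)
Definition hausdorff_dist (T : Type) (d : T -> T -> R) (A B : set T) : R :=
  Order.max (sup [set inf [set d a b | b in B] | a in A])
            (sup [set inf [set d a b | a in A] | b in B]).

End Metric.

Definition compacts (X : topologicalType) : Type :=
  set_type [set K : set X | compact K /\ K !=set0].

Section Vietoris.
Variable X : topologicalType.

Definition compacts_set (K : compacts X) : set X := val K.

HB.instance Definition _ := Choice.on (compacts X).

Definition vietoris_subbase (i : bool * set X) : set (compacts X) :=
  if i.1 then [set K | compacts_set K `<=` i.2]
  else [set K | compacts_set K `&` i.2 !=set0].

HB.instance Definition _ := @isSubBaseTopological.Build (compacts X)
  (bool * set X)%type [set i | open i.2] vietoris_subbase.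
End Vietoris.

Coercion compacts_set : compacts >-> set.

Section Words.
Variables (m : nat) (G : groupType).

(* A letter [(i, b)] stands for [x_i] if [b] is false, for [x_i^-1] if [b] is
   true. *)
Definition reduced (w : seq ('I_m * bool)) : bool :=
  sorted (fun a b => ~~ ((a.1 == b.1) && (a.2 != b.2))) w.

Definition word_eval (k : 'I_m -> G) (w : seq ('I_m * bool)) : G :=
  (\prod_(a <- w) (if a.2 then (k a.1)^-1 else k a.1))%g.
End Words.

Definition freely_generates (G : groupType) (K : set G) :=
  forall (m : nat) (k : 'I_m -> G), injective k -> (forall i, K (k i)) ->
  forall w, w != [::] -> reduced w -> word_eval k w <> 1%g.

HB.instance Definition _ (R : realType) :=
  PseudoPointedMetric.copy R[i] (R[i])^o.

Definition SU_set (R : realType) (n : nat) : set 'M[R[i]]_n :=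
  [set A | A \is unitarymx /\ \det A = 1].

Definition SU (R : realType) (n : nat) : Type := set_type (@SU_set R n).

Section SUGroup.
Variables (R : realType) (n : nat).
Local Notation SU := (SU R n).

HB.instance Definition _ := Topological.on SU.

Definition SU_mx (A : SU) : 'M[R[i]]_n := val A.

Fact SU_mxP (A : SU) : SU_mx A \is unitarymx /\ \det (SU_mx A) = 1.
Proof. exact: set_mem (valP A). Qed.

Fact SU_one_subproof :
  1%:M \in @SU_set R n.
Proof.
apply/mem_set; split; last exact: det1.
by apply/unitarymxP; rewrite trmx1 map_mx1 mulmx1.
Qed.

Fact SU_mul_subproof (A B : SU) :
  (SU_mx A *m SU_mx B) \in @SU_set R n.
Proof.
have [uA dA] := SU_mxP A; have [uB dB] := SU_mxP B.
by apply/mem_set; split; [exact: mul_unitarymx|rewrite det_mulmx dA dB mulr1].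
Qed.

Fact SU_inv_subproof (A : SU) :
  (SU_mx A)^t* \in @SU_set R n.
Proof.
have [uA dA] := SU_mxP A; apply/mem_set; split; first by rewrite trmxC_unitary.
by rewrite det_map_mx det_tr dA rmorph1.
Qed.

Definition SU_one : SU := exist (fun A => A \in @SU_set R n) _ SU_one_subproof.
Definition SU_mul (A B : SU) : SU :=
  exist (fun A => A \in @SU_set R n) _ (SU_mul_subproof A B).
Definition SU_inv (A : SU) : SU :=
  exist (fun A => A \in @SU_set R n) _ (SU_inv_subproof A).

Fact SU_mulA : associative SU_mul.
Proof. by move=> A B C; apply/val_inj; rewrite /= mulmxA. Qed.
Fact SU_mul1 : left_id SU_one SU_mul.
Proof. by move=> A; apply/val_inj; rewrite /= mul1mx. Qed.
Fact SU_mulr1 : right_id SU_one SU_mul.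
Proof. by move=> A; apply/val_inj; rewrite /= mulmx1. Qed.
Fact SU_mulV : right_inverse SU_one SU_inv SU_mul.
Proof. by move=> A; apply/val_inj/unitarymxP; case: (SU_mxP A). Qed.
Fact SU_mulVl : left_inverse SU_one SU_inv SU_mul.
Proof. by move=> A; apply/val_inj/mulmx1C/unitarymxP; case: (SU_mxP A). Qed.

HB.instance Definition _ :=
  isGroup.Build SU SU_mulA SU_mul1 SU_mulr1 SU_mulVl SU_mulV.
End SUGroup.

(* Coordinates are indexed by [nat]: coordinate [n] lies in [SU(n + 1)]. *)
Definition SUprod (R : realType) : Type := prod_topology (fun n => SU R n.+1).

Section SUprodGroup.
Variable R : realType.
Local Notation SUprod := (SUprod R).

HB.instance Definition _ := Topological.on SUprod.

Definition SUprod_one : SUprod := fun=> 1%g.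
Definition SUprod_mul (x y : SUprod) : SUprod := fun n => (x n * y n)%g.
Definition SUprod_inv (x : SUprod) : SUprod := fun n => ((x n)^-1)%g.

Fact SUprod_mulA : associative SUprod_mul.
Proof. by move=> x y z; apply: functional_extensionality_dep => n;
  exact: mulgA. Qed.
Fact SUprod_mul1 : left_id SUprod_one SUprod_mul.
Proof. by move=> x; apply: functional_extensionality_dep => n;
  exact: mul1g. Qed.
Fact SUprod_mulr1 : right_id SUprod_one SUprod_mul.
Proof. by move=> x; apply: functional_extensionality_dep => n;
  exact: mulg1. Qed.
Fact SUprod_mulV : left_inverse SUprod_one SUprod_inv SUprod_mul.
Proof. by move=> x; apply: functional_extensionality_dep => n;
  exact: mulVg. Qed.
Fact SUprod_mulrV : right_inverse SUprod_one SUprod_inv SUprod_mul.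
Proof. by move=> x; apply: functional_extensionality_dep => n;
  exact: mulgV. Qed.

HB.instance Definition _ := isGroup.Build SUprod
  SUprod_mulA SUprod_mul1 SUprod_mulr1 SUprod_mulV SUprod_mulrV.
End SUprodGroup.

Definition SUprod_dist (R : realType)
    (dn : forall n, SU R n.+1 -> SU R n.+1 -> R) (x y : SUprod R) : R :=
  limn (series (fun n => 2^-1 ^+ n.+1 * dn n (x n) (y n))).

(* [group_closed] contains [1 \in G], so the compact set is nonempty. *)
Definition csubgroup (R : realType) : Type :=
  set_type [set G : set (SUprod R) | compact G /\ group_closed [in G]].

Definition csubgroup_set (R : realType) (G : csubgroup R) : set (SUprod R) :=
  val G.

HB.instance Definition _ (R : realType) := Choice.on (csubgroup R).

Definition csubgroup_space (R : realType)
    (dn : forall n, SU R n.+1 -> SU R n.+1 -> R) : Type :=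
  metrized (fun G H : csubgroup R =>
    hausdorff_dist (SUprod_dist dn) (csubgroup_set G) (csubgroup_set H)).

HB.instance Definition _ (R : realType) dn :=
  Topological.on (@csubgroup_space R dn).

Definition csubgroup_sort (R : realType) (G : csubgroup R) : Type :=
  set_type (csubgroup_set G).

Section CsubgroupSort.
Variables (R : realType) (G : csubgroup R).

HB.instance Definition _ := SubChoice.on (csubgroup_sort G).
HB.instance Definition _ := Topological.on (csubgroup_sort G).

Fact csubgroup_group_closed : group_closed [in csubgroup_set G].
Proof. by have [] := set_mem (valP G). Qed.

HB.instance Definition _ := SubChoice_isSubGroup.Build
  (SUprod R) [in csubgroup_set G] (csubgroup_sort G) csubgroup_group_closed.
End CsubgroupSort.

Coercion csubgroup_sort : csubgroup >-> Sortclass.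

(* Main.v *)
(* A nonempty open set of compact sets contains a basic one, namely the compact
   sets covered by, and meeting each of, finitely many nonempty open sets; so a
   set of compact sets is nowhere dense as soon as such finite families can be
   refined to avoid it.  This gives Mycielski's theorem: if every box of
   nonempty open sets contains a smaller one on which a word has no solution of
   [w = 1], then for generic [K] no pairwise distinct elements of [K] satisfy
   [w = 1].  The words [x y^-1] also show that the group has no isolated point,
   so that a generic [K] is perfect and has the cardinality of the continuum.

   The hypothesis on boxes holds for generic [G]: replacing [G] by the group of
   the truncations of its elements to the first [N] coordinates, with an
   arbitrary even permutation matrix as the next coordinate, moves [G] by at most
   [2^-N], and for large [N] some even permutations of [N + 1] points do not
   satisfy [w = 1]. *)

Require Import Defs.
From HB Require Import structures.
From mathcomp Require Import finmap.
From mathcomp Require Import all_boot all_order all_algebra.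
From mathcomp Require Import fingroup perm action primitive_action alt.
From mathcomp Require Import spectral sesquilinear ring lra zify.
From mathcomp Require Import all_classical all_reals all_analysis.
From mathcomp Require Import complex.

Set Implicit Arguments.
Unset Strict Implicit.
Unset Printing Implicit Defensive.

Import Order.TTheory GRing.Theory Num.Theory.
Import numFieldNormedType.Exports.
Local Open Scope classical_set_scope.
Local Open Scope card_scope.
Local Open Scope complex_scope.
Local Open Scope ring_scope.

(** * Meager sets of compact sets *)

Lemma nowhere_dense_avoid (T : topologicalType) (A : set T) :
  (forall W, open W -> W !=set0 ->
    exists V, [/\ open V, V !=set0, V `<=` W & V `&` A = set0]) ->
  nowhere_dense A.
Proof.
move=> avoid; apply: contrapT => /eqP/set0P WA.
have [V [oV [x Vx] VW VA0]] := avoid _ (@open_interior _ _) WA.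
have clAx : closure A x by apply: interior_subset; exact: VW.
have [y [Ay Vy]] := clAx V (open_nbhs_nbhs (conj oV Vx)).
by have : (V `&` A) y by []; rewrite VA0.
Qed.

(** Lets words, tuples of basic sets and pairs serve as indices directly; numbers that code no index
    contribute the empty set. *)
Lemma meager_bigcup_countType (T : topologicalType) (I : countType)
    (F : I -> set T) (A : set T) :
  (forall i, nowhere_dense (F i)) -> A `<=` \bigcup_i F i -> meager A.
Proof.
move=> ndF AF; exists (fun n => if unpickle n is Some i then F i else set0).
split=> [n|x /AF[i _ Fix]]; last by exists (pickle i) => //; rewrite pickleK.
by case: unpickle => [i|]; [exact: ndF|rewrite /nowhere_dense closure0 interior0].
Qed.

Lemma meagerU (T : topologicalType) (A B : set T) :
  meager A -> meager B -> meager (A `|` B).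
Proof.
move=> [F [ndF AF]] [G [ndG BG]].
apply: (@meager_bigcup_countType _ (nat + nat)%type
  (fun i => match i with inl n => F n | inr n => G n end)).
  by case.
by move=> x [/AF[n _ ?]|/BG[n _ ?]]; [exists (inl n)|exists (inr n)].
Qed.

Lemma sub_meager (T : topologicalType) (A B : set T) :
  A `<=` B -> meager B -> meager A.
Proof. by move=> AB [F [ndF BF]]; exists F; split=> //; exact: subset_trans BF. Qed.

Lemma meager_bigcup (T : topologicalType) (I : countType) (F : I -> set T) :
  (forall i, meager (F i)) -> meager (\bigcup_i F i).
Proof.
move=> /choice[G GF].
apply: (@meager_bigcup_countType _ (I * nat)%type (fun i => G i.1 i.2)).
  by move=> [i n]; case: (GF i).
by move=> x [i _ /(proj2 (GF i))[n _ Gx]]; exists (i, n).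
Qed.

Definition countable_base (T : topologicalType) (I : countType)
    (B : I -> set T) :=
  (forall i, open (B i)) /\
  forall x A, nbhs x A -> exists2 i, B i x & B i `<=` A.

Lemma hausdorff_disjoint_nbhs (T : topologicalType) (m : nat) (k : 'I_m -> T) :
  hausdorff_space T -> injective k ->
  exists A : 'I_m -> set T, (forall i, nbhs (k i) (A i)) /\
    forall i j x, A i x -> A j x -> i = j.
Proof.
rewrite open_hausdorff => hT kI.
have /choice[S SP] : forall ij : 'I_m * 'I_m, exists AB : set T * set T,
    ij.1 != ij.2 -> [/\ nbhs (k ij.1) AB.1, nbhs (k ij.2) AB.2 &
      AB.1 `&` AB.2 = set0].
  move=> [i j]; case: (eqVneq i j) => [->|ij]; first by exists (setT, setT).
  have /hT[AB [/set_mem kA /set_mem kB] [oA oB /eqP AB0]] : k i != k j.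
    by apply: contra_neq ij => /kI.
  by exists AB; split=> //; apply: open_nbhs_nbhs.
(* The separating sets for [(i, j)] and for [(j, i)] are chosen independently, so the neighbourhood
   of [k i] is cut by its own side of both. *)
exists (fun i => [set x | forall j, i != j -> (S (i, j)).1 x /\ (S (j, i)).2 x]).
split=> [i|i j x Aix Ajx].
  apply: filter_forall => j; case: (eqVneq i j) => [_|ij]; first exact: nearW.
  have [Sl _ _] := SP (i, j) ij.
  have [|_ Sr _] := SP (j, i); first by rewrite eq_sym.
  by apply: filterS (filterI Sl Sr).
apply/eqP/negP => /negP ij.
have [S1 _] := Aix j ij.
have [|_ S2] := Ajx i; first by rewrite eq_sym.
have [_ _ S0] := SP (i, j) ij.
by have : ((S (i, j)).1 `&` (S (i, j)).2) x by []; rewrite S0.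
Qed.

(** * Basic open sets of the Vietoris topology *)

Section VietorisBox.
Variable X : topologicalType.

Definition vietoris_box (I : Type) (V : I -> set X) : set (compacts X) :=
  [set K | K `<=` \bigcup_i V i /\ forall i, K `&` V i !=set0].

Lemma vietoris_subbase_open (i : bool * set X) :
  open i.2 -> open (vietoris_subbase i).
Proof.
move=> oi; exists [set vietoris_subbase i]; last by rewrite bigcup_set1.
move=> _ ->; exists ([fset i]%fset).
  by move=> j; rewrite !inE => /eqP->.
by rewrite set_fset1 bigcap_set1.
Qed.

Lemma open_vietoris_box (I : finType) (V : I -> set X) :
  (forall i, open (V i)) -> open (vietoris_box V).
Proof.
move=> oV; rewrite openE => K [KV KVi].
have o1 : open (\bigcup_i V i) by apply: bigcup_open.
have n1 := open_nbhs_nbhs (conj (@vietoris_subbase_open (true, _) o1) KV).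
have n2 : \forall L \near K, forall i, vietoris_subbase (false, V i) L.
  apply: (@filter_forall _ _ (fun i => vietoris_subbase (false, V i))
    (nbhs K)) => i.
  exact: (open_nbhs_nbhs (conj (@vietoris_subbase_open (false, _) (oV i)) (KVi i))).
by apply: filterS (filterI n1 n2).
Qed.

(** A finite set with one point in each [V i] lies in the box; [i0] keeps this set nonempty, as an
    element of [compacts] must be. *)
Lemma vietoris_box_nonempty (I : finType) (i0 : I) (V : I -> set X) :
  (forall i, V i !=set0) -> vietoris_box V !=set0.
Proof.
move=> /choice[x Vx].
have cx : compact (range x) /\ range x !=set0.
  by split; [apply: finite_compact; exact: finite_image|exists (x i0), i0].
exists (exist (fun K => K \in [set K : set X | compact K /\ K !=set0]) _
  (mem_set cx)); split=> [_ [i _ <-]|i]; first by exists i.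
by exists (x i); split=> //; exists i.
Qed.

Lemma sub_vietoris_box (I : Type) (V V' : I -> set X) :
  (forall i, V' i `<=` V i) -> vietoris_box V' `<=` vietoris_box V.
Proof.
move=> V'V K [KV KVi]; split=> [x /KV[i _ /V'V Vx]|i]; first by exists i.
by have [x [Kx /V'V Vx]] := KVi i; exists x.
Qed.

Lemma open_vietoris_boxP (W : set (compacts X)) :
  open W -> W !=set0 ->
  exists (I : finType) (i0 : I) (V : I -> set X),
    [/\ forall i, open (V i), forall i, V i !=set0 & vietoris_box V `<=` W].
Proof.
move=> [D sD <-] [K [C DC CK]].
have [E sE EC] := sD _ DC.
have oE i : i \in E -> open i.2 by move=> /sE/set_mem.
have EK i : i \in E -> vietoris_subbase i K.
  by move=> iE; move: CK; rewrite -EC => /(_ i iE).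
(* All covering conditions of the basic neighbourhood together say that the compact set lies in
   [O]. *)
pose O := \bigcap_(i in [set` E]) (if i.1 then i.2 else setT).
have oO : open O.
  rewrite openE => x Ox; apply: filter_bigI => i iE.
  have := Ox i iE; case: i iE => -[] A /= iE Ax; last exact: filterT.
  by apply: open_nbhs_nbhs; split=> //; exact: (oE _ iE).
have KO : K `<=` O.
  by move=> x Kx [[] A] /= /EK // /(_ x Kx).
(* A meeting condition contributes its open set cut down to [O], a covering condition contributes
   [O]. The extra index [None], also sent to [O], makes the index type inhabited even when [E] is
   empty. *)
pose V (i : option E) := O `&` (if i is Some j then
  if (val j).1 then setT else (val j).2 else setT).
exists (option E), None, V; split.
- move=> [[[[] A] iE]|] /=; apply: openI => //; try exact: openT.
  exact: (oE _ iE).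
- have [_ [x Kx]] := set_mem (valP K).
  move=> [[[[] A] iE]|] /=.
  + by exists x; split=> //; exact: KO.
  + by have [y [Ky Ay]] := EK _ iE; exists y; split=> //; exact: KO.
  + by exists x; split=> //; exact: KO.
- move=> L [LV LVi]; exists C => //.
  suff : (\bigcap_(i in [set` E]) vietoris_subbase i) L.
    by rewrite -EC; apply.
  move=> [[] A] /= iE.
  + by move=> x /LV[i _ [/(_ _ iE)]].
  + have [y [Ly [_ Ay]]] := LVi (Some (FSetSub iE)).
    by exists y.
Qed.

Lemma vietoris_nowhere_dense (A : set (compacts X)) :
  (forall (I : finType) (i0 : I) (V : I -> set X),
    (forall i, open (V i)) -> (forall i, V i !=set0) ->
    exists (J : finType) (j0 : J) (V' : J -> set X),
      [/\ forall j, open (V' j), forall j, V' j !=set0,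
          vietoris_box V' `<=` vietoris_box V & vietoris_box V' `&` A = set0]) ->
  nowhere_dense A.
Proof.
move=> refine; apply: nowhere_dense_avoid => W oW W0.
have [I [i0 [V [oV V0 VW]]]] := open_vietoris_boxP oW W0.
have [J [j0 [V' [oV' V'0 V'V V'A]]]] := refine I i0 V oV V0.
exists (vietoris_box V'); split=> //; last exact: subset_trans VW.
- exact: open_vietoris_box.
- exact: vietoris_box_nonempty.
Qed.

End VietorisBox.

(** * Mycielski's theorem for one relation [P] *)

Section Mycielski.
Variables (X : topologicalType) (m : nat) (P : set ('I_m -> X)).

Hypothesis shrink : forall V : 'I_m -> set X,
  (forall i, open (V i)) -> (forall i, V i !=set0) ->
  exists V' : 'I_m -> set X,
    [/\ forall i, open (V' i), forall i, V' i !=set0,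
        forall i, V' i `<=` V i & forall k, (forall i, V' i (k i)) -> ~ P k].

(** Only the members selected by [s] are shrunk; since [s] is injective, each of them receives a
    single replacement. *)
Lemma shrink_injection (I : finType) (V : I -> set X) (s : 'I_m -> I) :
  injective s -> (forall i, open (V i)) -> (forall i, V i !=set0) ->
  exists V' : I -> set X,
    [/\ forall i, open (V' i), forall i, V' i !=set0,
        forall i, V' i `<=` V i & forall k, (forall i, V' (s i) (k i)) -> ~ P k].
Proof.
move=> sI oV V0.
have [U [oU U0 UV UP]] := shrink (fun i => oV (s i)) (fun i => V0 (s i)).
pose V' i := if [pick j | s j == i] is Some j then U j else V i.
have V's j : V' (s j) = U j.
  rewrite /V'; case: pickP => [j' /eqP/sI-> //|/(_ j)]; by rewrite eqxx.
exists V'; split.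
- by move=> i; rewrite /V'; case: pickP.
- by move=> i; rewrite /V'; case: pickP.
- by move=> i; rewrite /V'; case: pickP => [j /eqP<-|_ x //]; exact: UV.
- by move=> k kV'; apply: UP => i; rewrite -V's.
Qed.

(** There are finitely many injections, and they are treated one after another: further shrinking
    preserves what was achieved for the earlier ones. Finite functions are used so that they can be
    enumerated. *)
Lemma shrink_all_injections (I : finType) (V : I -> set X) :
  (forall i, open (V i)) -> (forall i, V i !=set0) ->
  exists V' : I -> set X,
    [/\ forall i, open (V' i), forall i, V' i !=set0,
        forall i, V' i `<=` V i & forall s : 'I_m -> I, injective s ->
          forall k, (forall i, V' (s i) (k i)) -> ~ P k].
Proof.
move=> oV V0.
suff [V' [oV' V'0 V'V V'P]] : exists V' : I -> set X,
    [/\ forall i, open (V' i), forall i, V' i !=set0,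
        forall i, V' i `<=` V i &
        forall s : {ffun 'I_m -> I}, s \in enum {ffun 'I_m -> I} ->
          injective s -> forall k, (forall i, V' (s i) (k i)) -> ~ P k].
  exists V'; split=> // s sI k kV'.
  apply: (V'P (finfun s)); first by rewrite mem_enum.
    by move=> i j; rewrite !ffunE => /sI.
  by move=> i; rewrite ffunE.
elim: (enum _) => [|s l [V' [oV' V'0 V'V V'P]]].
  by exists V; split=> // i x.
have [sI|nsI] := pselect (injective s); last first.
  by exists V'; split=> // t; rewrite inE => /predU1P[-> //|]; exact: V'P.
have [U [oU U0 UV' UP]] := shrink_injection sI oV' V'0.
exists U; split=> // [i x /UV'/V'V //|t].
rewrite inE => /predU1P[-> _|tl tI] k kU; first exact: UP.
by apply: V'P tl tI _ _ => i; exact: UV'.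
Qed.

(** If each member of a box meets at most one [U j], the points [k i] of [U i] lie in distinct
    members, so shrinking along all injections excludes [P k]. *)
Lemma nowhere_dense_disjoint_tuple (U : 'I_m -> set X) :
  (forall i, open (U i)) -> (forall i j x, U i x -> U j x -> i = j) ->
  nowhere_dense [set K : compacts X |
    exists k, [/\ forall i, compacts_set K (k i), forall i, U i (k i) & P k]].
Proof.
move=> oU dU; apply: vietoris_nowhere_dense => I i0 V oV V0.
(* A member meeting some [U j] is replaced by the intersection, which by disjointness meets no other
   [U j']. *)
have /choice[V1 V1P] : forall i, exists A : set X, [/\ open A, A !=set0,
    A `<=` V i & forall j j', A `&` U j !=set0 -> A `&` U j' !=set0 -> j = j'].
  move=> i; have [[j VU]|nVU] := pselect (exists j, V i `&` U j !=set0).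
    exists (V i `&` U j); split=> //; first exact: openI.
    by move=> a b [x [[_ Ux] Uax]] [y [[_ Uy] Uby]];
      rewrite -(dU _ _ _ Ux Uax) -(dU _ _ _ Uy Uby).
  by exists (V i); split=> // a b Va; case: nVU; exists a.
have [V2 [oV2 V20 V21 V2P]] := @shrink_all_injections I V1
  (fun i => let: And4 h _ _ _ := V1P i in h)
  (fun i => let: And4 _ h _ _ := V1P i in h).
exists I, i0, V2; split=> //.
  by apply: sub_vietoris_box => i x /V21; have [_ _ + _] := V1P i; exact.
rewrite -subset0 => K [[KV2 _] [k [Kk Uk Pk]]].
have /choice[s sP] : forall i, exists j, V2 j (k i).
  by move=> i; have [j _ ?] := KV2 _ (Kk i); exists j.
(* [s] is injective: a member containing both [k i] and [k j] meets [U i] and [U j], which forces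
   [i = j]. *)
apply: V2P Pk => // i j sij; have [_ _ _] := V1P (s i); apply.
  by exists (k i); split=> //; exact: V21.
by exists (k j); split=> //; rewrite sij; exact: V21.
Qed.

(** Distinct points of a Hausdorff space have pairwise disjoint basic neighbourhoods, and there are
    only countably many tuples of basic sets. Disjointness is part of [F u], so tuples of
    overlapping basic sets give the empty set. *)
Lemma mycielski (I : countType) (B : I -> set X) :
  hausdorff_space X -> countable_base B ->
  meager [set K : compacts X |
    exists k, [/\ injective k, forall i, compacts_set K (k i) & P k]].
Proof.
move=> hX [oB bB].
pose F (u : {ffun 'I_m -> I}) : set (compacts X) :=
  [set K | (forall i j x, B (u i) x -> B (u j) x -> i = j) /\
    exists k, [/\ forall i, compacts_set K (k i), forall i, B (u i) (k i) & P k]].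
apply: (@meager_bigcup_countType _ _ F) => [u|K [k [kI Kk Pk]]].
  have [du|ndu] := pselect (forall i j x, B (u i) x -> B (u j) x -> i = j).
    have := @nowhere_dense_disjoint_tuple (fun i => B (u i)) (fun i => oB _) du.
    by congr nowhere_dense; apply/seteqP; split=> K /=; rewrite /F/=; tauto.
  suff -> : F u = set0 by rewrite /nowhere_dense closure0 interior0.
  by rewrite -subset0 => K [].
have [A [kA dA]] := hausdorff_disjoint_nbhs hX kI.
have /choice[u uP] : forall i, exists a, B a (k i) /\ B a `<=` A i.
  by move=> i; have [a] := bB _ _ (kA i); exists a.
exists (finfun u) => //; split.
  move=> i j x; rewrite !ffunE => /(proj2 (uP i)) Aix /(proj2 (uP j)).
  exact: dA.
by exists k; split=> // i; rewrite ffunE; case: (uP i).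
Qed.

End Mycielski.

(** * Perfect compact sets and the continuum *)

Definition perfect_in (T : topologicalType) (K : set T) :=
  forall U, open U -> K `&` U !=set0 ->
    exists x y, [/\ (K `&` U) x, (K `&` U) y & x <> y].

(** A set with an isolated point meets some basic [B i] in exactly one point. If a member of a box
    meets [B i], the absence of isolated points in the space yields two disjoint open subsets of the
    intersection; adding both to the box forces two points in [B i]. If no member meets [B i],
    neither does any set of the box. *)
Lemma meager_not_perfect (X : topologicalType) (I : countType)
    (B : I -> set X) :
  hausdorff_space X -> countable_base B -> perfect_in [set: X] ->
  meager [set K : compacts X | ~ perfect_in (compacts_set K)].
Proof.
move=> hX [oB bB] pX.
pose F i := [set K : compacts X | K `&` B i !=set0 /\
  forall x y, (K `&` B i) x -> (K `&` B i) y -> x = y].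
apply: (@meager_bigcup_countType _ _ F) => [i|K /existsNP[U /not_implyP[oU]]].
  apply: vietoris_nowhere_dense => J j0 V oV V0.
  have [[j VB]|nVB] := pselect (exists j, V j `&` B i !=set0); last first.
    exists J, j0, V; split=> //; rewrite -subset0 => K [[KV _] [[x [Kx Bx]] _]].
    by have [j _ Vx] := KV x Kx; case: nVB; exists j, x.
  have [|x [y [[_ VBx] [_ VBy] xy]]] := pX _ (openI (oV j) (oB i)).
    by rewrite setTI.
  move: hX; rewrite open_hausdorff => /(_ x y); case; first exact/eqP.
  move=> [A C] /= [/set_mem Ax /set_mem Cy] [oA oC /eqP AC0].
  pose V' (l : option (option J)) := match l with
    | None => V j `&` B i `&` A
    | Some None => V j `&` B i `&` C
    | Some (Some l) => V l end.
  exists (option (option J)), None, V'; split.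
  - by move=> [[l|]|] //=; apply: openI => //; apply: openI.
  - by move=> [[l|]|] //=; [exists y|exists x].
  - move=> K [KV' KVi']; split; last by move=> l; exact: (KVi' (Some (Some l))).
    by move=> z /KV'[[[l|]|] _]; [exists l|move=> [[? _] _]; exists j..].
  - rewrite -subset0 => K [[_ KV'] [_ K1]].
    have [a [Ka [[_ Ba] Aa]]] := KV' None.
    have [c [Kc [[_ Bc] Cc]]] := KV' (Some None).
    have ac : a = c by exact: K1.
    have : (A `&` C) a by split=> //; rewrite ac.
    by rewrite AC0.
move=> /not_implyP[[x [Kx Ux]]] nKU.
have [i Bx BU] := bB _ _ (open_nbhs_nbhs (conj oU Ux)).
exists i => //; split; first by exists x.
move=> y z [Ky By] [Kz Bz]; apply: contrapT => yz; apply: nKU.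
by exists y, z; split=> //; split=> //; exact: BU.
Qed.

(** Regularity of a compact Hausdorff set, with closures taken in the ambient space. If every [V]
    fails, the sets [closure V] cut by [K] minus [U] generate a proper filter. A cluster point of it
    in [K] cannot lie in [U], so it differs from [y], and separating it from [y] is
    contradictory. *)
Lemma compact_shrink_nbhs (T : topologicalType) (K U : set T) (y : T) :
  hausdorff_space T -> compact K -> open U -> K y -> U y ->
  exists V, [/\ open V, V y & closure V `&` K `<=` U].
Proof.
move=> hT cK oU Ky Uy; apply: contrapT => nV.
pose F := filter_from (nbhs y) (fun V => closure V `&` (K `&` ~` U)).
have FF : ProperFilter F.
  apply: filter_from_proper => [|V]; last first.
    rewrite nbhsE => -[W [oW Wy] WV]; apply: contrapT => VKU.
    apply: nV; exists W; split=> // x [Wx Kx]; apply: contrapT => Ux.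
    by apply: VKU; exists x; split=> //; apply: closure_subset Wx.
  apply: filter_from_filter => [|V W yV yW]; first by exists setT; exact: filterT.
  exists (V `&` W); first exact: filterI.
  by move=> x [VWx KUx]; split; split=> //; apply: closure_subset VWx => z [].
have FK : F K by exists setT; [exact: filterT|move=> x [_ []]].
have [z [Kz Fz]] := cK F FF FK.
have [Uz|nUz] := pselect (U z).
  have [|x [nUx Ux]] := Fz (~` U) U _ (open_nbhs_nbhs (conj oU Uz)).
    by exists setT; [exact: filterT|move=> x [_ []]].
  by [].
have : y != z by apply/eqP => yz; apply: nUz; rewrite -yz.
move: hT; rewrite open_hausdorff => h /h[[A C]] /=.
move=> [/set_mem Ay /set_mem Cz] [oA oC /eqP AC0].
have FA : F (closure A) by exists A; [exact: open_nbhs_nbhs|move=> x []].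
have [x [Ax Cx]] := Fz _ _ FA (open_nbhs_nbhs (conj oC Cz)).
have [w] := Ax _ (open_nbhs_nbhs (conj oC Cx)).
by rewrite AC0.
Qed.

(** * Cantor schemes in perfect compact sets *)

Section CantorScheme.
Variables (T : topologicalType) (K : set T).
Hypotheses (hT : hausdorff_space T) (cK : compact K) (K0 : K !=set0)
  (pK : perfect_in K).

Lemma perfect_split (U : set T) : open U -> K `&` U !=set0 ->
  exists V : bool -> set T, [/\ forall b, open (V b),
    forall b, K `&` V b !=set0, forall b, V b `<=` U &
    forall x, K x -> closure (V false) x -> closure (V true) x -> False].
Proof.
move=> oU /(pK oU)[x [y [[Kx Ux] [Ky Uy] xy]]].
move: (hT); rewrite open_hausdorff => /(_ x y); case; first exact/eqP.
move=> [A C] /= [/set_mem Ax /set_mem Cy] [oA oC /eqP AC0].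
have [V [oV Vx VA]] := compact_shrink_nbhs hT cK oA Kx Ax.
have [W [oW Wy WC]] := compact_shrink_nbhs hT cK oC Ky Cy.
exists (fun b => (if b then V else W) `&` U); split.
- by move=> []; apply: openI.
- by case; [exists x|exists y].
- by move=> b z [].
- move=> z Kz Wz Vz; suff : (A `&` C) z by rewrite AC0.
  split; [apply: VA; split=> //; apply: closure_subset Vz => t []//|].
  by apply: WC; split=> //; apply: closure_subset Wz => t [].
Qed.

Lemma cantor_scheme : exists V : (nat -> bool) -> nat -> set T,
  [/\ forall c n, K `&` V c n !=set0,
      forall c n, V c n.+1 `<=` V c n &
      forall c d n, (forall i, (i < n)%N -> c i = d i) -> c n != d n ->
        forall x, K x -> closure (V c n.+1) x -> closure (V d n.+1) x -> False].
Proof.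
have /choice[S SP] : forall U, exists V : bool -> set T,
    open U -> K `&` U !=set0 -> [/\ forall b, open (V b),
    forall b, K `&` V b !=set0, forall b, V b `<=` U &
    forall x, K x -> closure (V false) x -> closure (V true) x -> False].
  move=> U; have [[oU KU]|nU] := pselect (open U /\ K `&` U !=set0).
    by have [V VP] := perfect_split oU KU; exists V.
  by exists (fun=> setT) => oU KU; case: nU.
pose V c := fix V n := if n is n.+1 then S (V n) (c n) else setT.
have VP c n : open (V c n) /\ K `&` V c n !=set0.
  elim: n => [|n [oV KV]] /=; first by rewrite setIT; split=> //; exact: openT.
  by have [] := SP _ oV KV.
exists V; split=> [c n|c n x Vx|c d n cd cdn x Kx].
- by have [] := VP c n.
- by have [oV KV] := VP c n; have [_ _ + _] := SP _ oV KV; apply; exact: Vx.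
(* The set at level [n] depends only on the first [n] choices, so [c] and [d] reach the same set
   there and then take its two different halves. *)
have -> : V c n.+1 = S (V d n) (c n).
  rewrite /=; congr S; elim: n cd {cdn} => //= n IH cd.
  by rewrite (cd n)// IH// => i /ltnW; exact: cd.
have [oV KV] := VP d n; have [_ _ _ h] := SP _ oV KV.
by move: cdn => /=; case: (c n) (d n) => -[] // _ ? ?; apply: (h x).
Qed.

(** Compactness gives each branch a point of [K] in all closures along it. Where two branches first
    differ, these closures are disjoint inside [K], so distinct branches have distinct points. *)
Lemma perfect_card_ge : [set: nat -> bool] #<= K.
Proof.
have [V [KV VS Vd]] := cantor_scheme.
have Vle c m n : (m <= n)%N -> V c n `<=` V c m.
  by move=> /subnK <-; elim: (n - m)%N => //= k IH; rewrite addSn => x /VS/IH.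
have /choice[p pP] : forall c, exists p, K p /\ forall n, closure (V c n) p.
  move=> c; pose F := filter_from [set: nat] (fun n => K `&` V c n).
  have FF : ProperFilter F.
    apply: filter_from_proper => [|n _]; last exact: KV.
    apply: filter_from_filter => [|m n _ _]; first by exists 0%N.
    exists (maxn m n) => // x [Kx Vx].
    by split; split=> //; apply: Vle Vx; rewrite ?leq_maxl ?leq_maxr.
  have FV n : F (K `&` V c n) by exists n.
  have FK : F K by apply: filterS (FV 0%N) => x [].
  have [x [Kx Fx]] := cK FF FK.
  exists x; split=> // n A /(Fx _ _ (FV n))[y [[_ Vy] Ay]].
  by exists y.
have pI : injective p.
  move=> c d pcd; apply: contrapT => cd.
  have : exists n, c n != d n.
    by apply: contrapT => /forallNP h; apply: cd; apply/funext => n;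
      have /negP := h n; rewrite negbK => /eqP.
  case/ex_minnP => n cdn min.
  have [Kc Vc] := pP c; have [_ Vdd] := pP d.
  apply: (Vd c d n _ cdn (p c)) => //; last by rewrite pcd.
  move=> i; rewrite ltnNge; apply: contraNeq; exact: min.
have : p @` [set: nat -> bool] #= [set: nat -> bool].
  by apply: inj_card_eq => c d _ _ /pI.
rewrite card_eq_le => /andP[_ h].
apply: card_le_trans h _; apply: subset_card_le => _ [c _ <-].
by have [] := pP c.
Qed.

End CantorScheme.

(** In a Hausdorff space a point is determined by the set of codes of the basic sets that contain
    it. *)
Lemma countable_base_card_le (T : topologicalType) (I : countType)
    (B : I -> set T) (K : set T) :
  hausdorff_space T -> countable_base B -> K #<= [set: nat -> bool].
Proof.
move=> hT [_ bB].
pose f x n := `[< if unpickle n is Some i then B i x else False >].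
have fI : injective f.
  move=> x y fxy; apply: contrapT => /eqP xy.
  move: hT; rewrite open_hausdorff => /(_ _ _ xy)[[A C]] /=.
  move=> [/set_mem Ax /set_mem Cy] [oA oC /eqP AC0].
  have [i Bx BA] := bB _ _ (open_nbhs_nbhs (conj oA Ax)).
  have /asboolP : f y (pickle i) by rewrite -fxy; apply/asboolP; rewrite pickleK.
  by rewrite pickleK => /BA Ay; have : (A `&` C) y by []; rewrite AC0.
have : f @` K #= K by apply: inj_card_eq => c d _ _ /fI.
rewrite card_eq_le => /andP[_ h].
by apply: card_le_trans h _; exact: subset_card_le.
Qed.

Lemma rat_intervals_base (R : realType) :
  countable_base (fun q : rat * rat => `]ratr q.1, ratr q.2[%classic : set R).
Proof.
split=> [q|x A]; first exact: interval_open.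
move=> /nbhs_ballP[e /= e0 eA].
have [p] : exists q : rat, ratr q \in `](x - e), x[%R.
  by apply: rat_in_itvoo; rewrite ltrBlDr ltrDl.
have [q] : exists q : rat, ratr q \in `]x, (x + e)[%R.
  by apply: rat_in_itvoo; rewrite ltrDl.
rewrite !in_itv /= => /andP[xq qe] /andP[ep px].
exists (p, q); first by rewrite /= in_itv /= px.
move=> y /=; rewrite in_itv /= => /andP[py yq]; apply: eA.
rewrite /ball /= ltr_distlC; apply/andP; split; first exact: lt_trans py.
exact: lt_trans qe.
Qed.

Lemma card_real (R : realType) : [set: R] #= [set: nat -> bool].
Proof.
rewrite card_eq_le; apply/andP; split.
  apply: countable_base_card_le (rat_intervals_base R); exact: Rhausdorff.
apply: card_le_trans (subset_card_le (@subsetT _ `[0 : R, 1]%classic)).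
apply: perfect_card_ge.
- exact: Rhausdorff.
- exact: segment_compact.
- by exists 0; rewrite /= in_itv /= lexx ler01.
move=> U oU [x [/=]]; rewrite in_itv /= => /andP[x0 x1] Ux.
have /nbhs_ballP[e /= e0 eU] := open_nbhs_nbhs (conj oU Ux).
(* Below [e], so the second point stays in [U]; at most 1/2, so [x + d] or [x - d] stays in the unit
   interval, according to the half that contains [x]. *)
pose d := Num.min e 1 / 2.
have d0 : 0 < d by rewrite divr_gt0// lt_min e0 ltr01.
have de : d < e.
  rewrite ltr_pdivrMr// (le_lt_trans (_ : _ <= e))//.
    by rewrite ge_min lexx.
  by rewrite ltr_pMr// ltr1n.
have d1 : d <= 1 / 2 by rewrite ler_pM2r ?invr_gt0// ge_min lexx orbT.
have Kx : (`[0, 1]%classic `&` U) x by split=> //=; rewrite in_itv /= x0.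
have [xh|hx] := leP x (1 / 2).
  exists x, (x + d); split=> //; last first.
    by apply/eqP; rewrite eq_sym -subr_eq0 addrAC subrr add0r gt_eqF.
  split=> /=; first by rewrite in_itv /= addr_ge0 ?(ltW d0)//=; lra.
  by apply: eU; rewrite /ball /= opprD addNKr normrN gtr0_norm.
exists x, (x - d); split=> //; last first.
  by apply/eqP; rewrite -subr_eq0 opprB addrC subrK gt_eqF.
split=> /=; first by rewrite in_itv /=; apply/andP; split; lra.
by apply: eU; rewrite /ball /= opprB addrC subrK gtr0_norm.
Qed.

(** * The topology of the product of the special unitary groups *)

Lemma continuous_Re (R : realType) : continuous (@complex.Re R : R[i] -> R).
Proof.
move=> z A /nbhs_ballP[e /= e0 eA]; apply/nbhs_ballP; exists e%:C.
  by rewrite /= ltcR.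
move=> w zw; apply: eA; rewrite /ball /= -ltcR.
by apply: le_lt_trans zw; rewrite -raddfB; exact: normc_ge_Re.
Qed.

Lemma normc_ge_Im (R : rcfType) (z : R[i]) : `|complex.Im z|%:C <= `|z|.
Proof.
case: z => x y /=; apply: le_trans (normc_ge_Re (y +i* (- x))%C) _.
by rewrite !normc_def /= sqrrN addrC.
Qed.

Lemma continuous_Im (R : realType) : continuous (@complex.Im R : R[i] -> R).
Proof.
move=> z A /nbhs_ballP[e /= e0 eA]; apply/nbhs_ballP; exists e%:C.
  by rewrite /= ltcR.
move=> w zw; apply: eA; rewrite /ball /= -ltcR.
by apply: le_lt_trans zw; rewrite -raddfB; exact: normc_ge_Im.
Qed.

Lemma normc_le_ReIm (R : realType) (z : R[i]) :
  `|z| <= (`|complex.Re z| + `|complex.Im z|)%:C.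
Proof.
rewrite {1}[z]complexE rmorphD; apply: le_trans (ler_normD _ _) _.
rewrite normrM !normc_def /= !expr0n /= !addr0 add0r expr1n sqrtr1 mul1r.
by rewrite !sqrtr_sqr.
Qed.

Lemma complex_base (R : realType) : countable_base
  (fun q : (rat * rat) * (rat * rat) => [set z : R[i] |
    `]ratr q.1.1, ratr q.1.2[%classic (complex.Re z) /\
    `]ratr q.2.1, ratr q.2.2[%classic (complex.Im z)]).
Proof.
have [oI bI] := rat_intervals_base R.
split=> [[p q] /=|z A /nbhs_ballP[e /= e0 eA]].
  have /continuousP cRe := @continuous_Re R.
  have /continuousP cIm := @continuous_Im R.
  by apply: openI; [exact: cRe _ (oI p)|exact: cIm _ (oI q)].
(* The radius [e] is a positive complex number, hence real; half of it is allotted to each of the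
   real and imaginary parts. *)
have r0 : 0 < complex.Re e / 2.
  by move: e0; rewrite ltcE /= => /andP[_ e0]; rewrite divr_gt0.
have eE : e = (complex.Re e / 2 + complex.Re e / 2)%:C.
  by rewrite -splitr RRe_real// gtr0_real.
have [p pz pA] := bI _ _ (nbhsx_ballx (complex.Re z) _ r0).
have [q qz qA] := bI _ _ (nbhsx_ballx (complex.Im z) _ r0).
exists (p, q) => //= w [/pA + /qA]; rewrite /ball /= => wr wi.
apply: eA; rewrite /ball /= eE; apply: le_lt_trans (normc_le_ReIm _) _.
by rewrite ltcR !raddfB ltrD.
Qed.

Lemma matrix_base (T : topologicalType) (I : countType) (B : I -> set T) m n :
  countable_base B -> countable_base
    (fun M : 'M[I]_(m, n) => [set A : 'M[T]_(m, n) | forall i j, B (M i j) (A i j)]).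
Proof.
move=> [oB bB]; split=> [M|A C [P AP PC]].
  rewrite openE => A MA; exists (fun i j => B (M i j)) => // i j.
  exact: open_nbhs_nbhs.
have /choice[M MP] : forall ij, exists l,
    B l (A ij.1 ij.2) /\ B l `<=` P ij.1 ij.2.
  by move=> [i j]; have [l] := bB _ _ (AP i j); exists l.
exists (\matrix_(i, j) M (i, j)) => [i j|D DB].
  by rewrite mxE; case: (MP (i, j)).
apply: PC => i j; have := DB i j; rewrite mxE; exact: (proj2 (MP (i, j))).
Qed.

(** Passes a base from matrices to the special unitary group, and from the product to a compact
    subgroup. *)
Lemma initial_base (S : choiceType) (T : topologicalType) (I : countType)
    (B : I -> set T) (f : S -> T) :
  countable_base B ->
  countable_base (fun i => f @^-1` B i : set (initial_topology f)).
Proof.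
move=> [oB bB]; split=> [i|x A]; first by exists (B i).
rewrite nbhsE => -[_ [[U oU <-] Ux] UA].
have [i Bx BU] := bB _ _ (open_nbhs_nbhs (conj oU Ux)).
by exists i => // y /BU/UA.
Qed.

(** With natural numbers as the common index in all coordinates, a finite sequence codes a cylinder
    of the product. *)
Lemma nat_base (T : topologicalType) (I : countType) (B : I -> set T) :
  countable_base B -> exists C : nat -> set T, countable_base C.
Proof.
move=> [oB bB]; exists (fun n => if unpickle n is Some i then B i else set0).
split=> [n|x A /bB[i Bx BA]]; last by exists (pickle i); rewrite pickleK.
by case: unpickle => // *; exact: open0.
Qed.

(** * Countable products *)

Section NatProduct.
Variable T : nat -> topologicalType.

Lemma prod_nbhs_cylinder (x : prod_topology T) (A : set (prod_topology T)) :
  nbhs x A -> exists N (U : forall n, set (T n)),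
    (forall n, nbhs (x n) (U n)) /\
    forall y : prod_topology T, (forall n, (n < N)%N -> U n (y n)) -> A y.
Proof.
pose F : set_system (prod_topology T) := fun A => exists N (U : forall n, set (T n)),
    (forall n, nbhs (x n) (U n)) /\
    forall y : prod_topology T, (forall n, (n < N)%N -> U n (y n)) -> A y.
have FF : Filter F.
  split.
  - by exists 0%N, (fun=> setT); split=> // n; exact: filterT.
  - move=> P Q [M [U [xU UP]]] [N [V [xV VQ]]].
    exists (maxn M N), (fun n => U n `&` V n); split=> [n|y UVy].
      exact: filterI.
    split; [apply: UP|apply: VQ] => n nM.
      by have [|//] := UVy n; rewrite leq_max nM.
    by have [|//] := UVy n; rewrite leq_max nM orbT.
  - by move=> P Q PQ [N [U [xU UP]]]; exists N, U; split=> // y /UP/PQ.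
(* The sets containing a cylinder around [x] form a filter. The product topology is a supremum of
   initial topologies, so its convergence to [x] is checked one coordinate at a time. *)
suff : F --> x by apply.
apply/cvg_sup => i B; rewrite nbhsE => -[_ [[C oC <-] Cx] CB].
(* The constraint on coordinate [i] is phrased through points [y] of the product, which avoids
   transporting [t] from [T n] to [T i]; for [n] other than [i] it is vacuous. *)
exists i.+1, (fun n => [set t | forall y : prod_topology T,
  y n = t -> n = i -> C (y i)]); split=> [n|y yU]; last first.
  by apply: CB; exact: (yU i (leqnn _) y).
case: (eqVneq n i) => [->|ni]; last by apply: nearW => t y _ ?; move/eqP: ni.
apply: filterS (open_nbhs_nbhs (conj oC Cx)) => t Ct y yt _.
by rewrite yt.
Qed.

Lemma nbhs_proj (x : prod_topology T) n (U : set (T n)) :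
  nbhs (x n) U -> nbhs x [set y : prod_topology T | U (y n)].
Proof. exact: (@proj_continuous _ T n x). Qed.

Lemma continuous_prod (Y : topologicalType) (f : Y -> prod_topology T) :
  (forall n, continuous (fun y => f y n)) -> continuous f.
Proof.
move=> cf y A /prod_nbhs_cylinder[N [U [yU UA]]].
have : \forall z \near y, forall n : 'I_N, U n (f z n).
  by apply: filter_forall => n; exact: (cf n y (U n) (yU n)).
apply: filterS => z Uz; apply: UA => n nN; exact: (Uz (Ordinal nN)).
Qed.

Lemma prod_base (B : forall n, nat -> set (T n)) :
  (forall n, countable_base (B n)) ->
  countable_base (fun s : seq nat =>
    [set x : prod_topology T | forall n, (n < size s)%N -> B n (nth 0%N s n) (x n)]).
Proof.
move=> bB; split=> [s|x A /prod_nbhs_cylinder[N [U [xU UA]]]].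
  rewrite openE => x xs.
  have xB (n : 'I_(size s)) :
      nbhs x [set y : prod_topology T | B n (nth 0%N s n) (y n)].
    apply: (@nbhs_proj x n); apply: open_nbhs_nbhs.
    by split; [have [] := bB n|exact: xs].
  have := filter_forall (nbhs_filter x) xB.
  by apply: filterS => y ys n nN; exact: (ys (Ordinal nN)).
have /choice[f fP] : forall n, exists i, B n i (x n) /\ B n i `<=` U n.
  by move=> n; have [_ b] := bB n; have [l] := b _ _ (xU n); exists l.
exists (mkseq f N) => /=; rewrite size_mkseq.
  by move=> n nN; rewrite nth_mkseq//; case: (fP n).
move=> y yB; apply: UA => n nN; have := yB n nN; rewrite nth_mkseq//.
exact: (proj2 (fP n)).
Qed.

End NatProduct.

Lemma continuous_to_matrix (Y T : topologicalType) m n (f : Y -> 'M[T]_(m, n)) :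
  (forall i j, continuous (fun y => f y i j)) -> continuous f.
Proof.
move=> cf y A [P yP PA].
have : \forall z \near y, forall ij : 'I_m * 'I_n, P ij.1 ij.2 (f z ij.1 ij.2).
  by apply: filter_forall => -[i j]; exact: (cf i j y _ (yP i j)).
by apply: filterS => z Pz; apply: PA => i j; exact: (Pz (i, j)).
Qed.

Lemma continuous_entry (T : topologicalType) m n i j :
  continuous (fun A : 'M[T]_(m, n) => A i j).
Proof.
move=> A U AU.
exists (fun k l => if (k == i) && (l == j) then U else setT) => [k l|B].
  by case: ifP => [/andP[/eqP-> /eqP->] //|_]; exact: filterT.
by move=> /(_ i j); rewrite !eqxx.
Qed.

Lemma continuous_to_initial (S : choiceType) (Y T : topologicalType) (f : S -> T)
    (g : Y -> initial_topology f) :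
  continuous (f \o g : Y -> T) -> continuous g.
Proof.
move=> /continuousP cg; apply/continuousP => _ [A oA <-]; exact: cg.
Qed.

Lemma hausdorff_separated (X : topologicalType) :
  (forall x y : X, x <> y -> exists (Y : topologicalType) (f : X -> Y),
    [/\ hausdorff_space Y, continuous f & f x <> f y]) -> hausdorff_space X.
Proof.
move=> sep x y xy; apply: contrapT => /sep[Y [f [hY cf]]]; apply; apply: hY.
move=> A B fxA fyB; have [z [Az Bz]] := xy _ _ (cf _ _ fxA) (cf _ _ fyB).
by exists (f z).
Qed.

(** Yields the continuity of an entry of a matrix product. *)
Lemma cvg_sum_mul (K : numFieldType) (Y : Type) (F : set_system Y) (m : nat)
    (f g : 'I_m -> Y -> K) (a b : 'I_m -> K) :
  Filter F -> (forall k, f k @ F --> a k) -> (forall k, g k @ F --> b k) ->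
  (fun y => \sum_k f k y * g k y) @ F --> \sum_k a k * b k.
Proof.
move=> FF fa gb; apply: (@cvg_big K _ +%R) => [|k _].
  by move=> q; apply: cvgD; [exact: cvg_fst|exact: cvg_snd].
by apply: cvgM.
Qed.

(** * The product of the special unitary groups as a topological group *)

Section SUprodTopology.
Variable R : realType.

Lemma SUprod_base : exists B : seq nat -> set (SUprod R), countable_base B.
Proof.
have exB n : exists B : nat -> set (SU R n.+1), countable_base B.
  apply: nat_base.
  apply: (@initial_base _ _ _ _ (@set_val _ (@SU_set R n.+1))).
  by apply: matrix_base; exact: complex_base.
exists (fun s => [set x : SUprod R |
  forall n, (n < size s)%N -> projT1 (cid (exB n)) (nth 0%N s n) (x n)]).
exact: (@prod_base (fun n => SU R n.+1) (fun n => projT1 (cid (exB n)))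
  (fun n => projT2 (cid (exB n)))).
Qed.

Lemma continuous_SU_mx n : continuous (@SU_mx R n : SU R n -> 'M[R[i]]_n).
Proof. exact: initial_continuous. Qed.

Lemma continuous_SUprod_entry n i j :
  continuous (fun x : SUprod R => SU_mx (x n) i j).
Proof.
move=> x U xU; apply: (@nbhs_proj (fun n => SU R n.+1) x n
  [set y | U (SU_mx y i j)]).
exact: (@continuous_SU_mx n.+1 (x n) [set M | U (M i j)] (continuous_entry xU)).
Qed.

Lemma continuous_to_SUprod (Y : topologicalType) (f : Y -> SUprod R) :
  (forall n i j, continuous (fun y => SU_mx (f y n) i j)) -> continuous f.
Proof.
move=> cf; apply: continuous_prod => n.
apply: (@continuous_to_initial _ _ _ (@set_val _ (@SU_set R n.+1))).
by apply: continuous_to_matrix => i j; exact: cf.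
Qed.

Lemma SUprod_hausdorff : hausdorff_space (SUprod R).
Proof.
apply: hausdorff_separated => x y xy.
have [n xyn] : exists n, x n <> y n.
  by apply/existsNP => h; apply: xy; apply: functional_extensionality_dep.
have [[i j] /= xyij] : exists ij, SU_mx (x n) ij.1 ij.2 <> SU_mx (y n) ij.1 ij.2.
  apply/existsNP => h; apply: xyn; apply: val_inj; apply/matrixP => i j.
  exact: (h (i, j)).
exists R[i], (fun x : SUprod R => SU_mx (x n) i j); split=> //.
  exact: (@norm_hausdorff _ (R[i])^o).
exact: continuous_SUprod_entry.
Qed.

Lemma SUprod_mul_continuous :
  continuous (fun p : SUprod R * SUprod R => (p.1 * p.2)%g).
Proof.
apply: continuous_to_SUprod => n i j p.
have -> : (fun p : SUprod R * SUprod R => SU_mx ((p.1 * p.2)%g n) i j) =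
    (fun p => \sum_k SU_mx (p.1 n) i k * SU_mx (p.2 n) k j).
  by apply/funext => q; rewrite /= mxE.
apply: (@cvg_sum_mul R[i] _ (nbhs p) _
    (fun k (q : SUprod R * SUprod R) => SU_mx (q.1 n) i k)
    (fun k (q : SUprod R * SUprod R) => SU_mx (q.2 n) k j)) => k.
  apply: (@cvg_comp _ _ _ fst (fun x : SUprod R => SU_mx (x n) i k) _ (nbhs p.1)).
    exact: cvg_fst.
  exact: (@continuous_SUprod_entry n i k p.1).
apply: (@cvg_comp _ _ _ snd (fun x : SUprod R => SU_mx (x n) k j) _ (nbhs p.2)).
  exact: cvg_snd.
exact: (@continuous_SUprod_entry n k j p.2).
Qed.

Lemma conjC_continuous : continuous (fun z : R[i] => z^*%R).
Proof.
move=> z A /nbhs_ballP[e e0 eA]; apply/nbhs_ballP; exists e => // w.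
by move=> zw; apply: eA; move: zw; rewrite /ball /= -rmorphB norm_conjC.
Qed.

Lemma SUprod_inv_continuous : continuous (fun x : SUprod R => (x^-1)%g).
Proof.
apply: continuous_to_SUprod => n i j x.
have -> : (fun x : SUprod R => SU_mx ((x^-1)%g n) i j) =
    (fun z : R[i] => z^*%R) \o (fun x : SUprod R => SU_mx (x n) j i).
  by apply/funext => y; rewrite /= !mxE.
apply: continuous_comp; first exact: continuous_SUprod_entry.
exact: conjC_continuous.
Qed.

End SUprodTopology.

(** * Words and even permutations *)

Lemma word_eval_cons m (G : groupType) (k : 'I_m -> G) a w :
  word_eval k (a :: w) =
  ((if a.2 then (k a.1)^-1 else k a.1) * word_eval k w)%g.
Proof. exact: big_cons. Qed.

Lemma word_eval_rcons m (G : groupType) (k : 'I_m -> G) a w :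
  word_eval k (rcons w a) =
  (word_eval k w * (if a.2 then (k a.1)^-1 else k a.1))%g.
Proof. exact: big_rcons. Qed.

(** Multiplicativity is asked on a subgroup [S] only, so that [SU_perm], which is multiplicative on
    even permutations, is covered along with projections and inclusions. *)
Lemma word_eval_morph m (G H : groupType) (f : G -> H) (S : pred G)
    (k : 'I_m -> G) w :
  f 1%g = 1%g -> (forall i, k i \in S) -> group_closed S ->
  {in S &, {morph f : x y / (x * y)%g}} ->
  f (word_eval k w) = word_eval (f \o k) w.
Proof.
move=> f1 kS [S1 Sd] fM.
have SV x : x \in S -> (x^-1)%g \in S by move=> xS; rewrite -div1g Sd.
have SM x y : x \in S -> y \in S -> (x * y)%g \in S.
  by move=> xS yS; rewrite -[y]invgK Sd ?SV.
have fV x : x \in S -> f (x^-1)%g = ((f x)^-1)%g.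
  by move=> xS; apply/eqP; rewrite -mulg_eq1 -fM ?SV// mulVg f1.
suff [] : word_eval k w \in S /\ f (word_eval k w) = word_eval (f \o k) w by [].
elim: w => [|[i b] w [wS IH]]; first by rewrite /word_eval !big_nil.
rewrite !word_eval_cons /= -IH; case: b; split;
  by rewrite ?SM ?fM ?SV ?fV.
Qed.

(** The alternating group of [n + 3] points is [(n + 1)]-transitive. *)
Lemma Alt_extend n (s t : seq 'I_n.+3) :
  uniq s -> uniq t -> size s = size t -> (size s <= n.+1)%N ->
  exists2 p : {perm 'I_n.+3}, p \in ('Alt_('I_n.+3))%g & map p s = t.
Proof.
move=> us ut st sn.
have sP : size t == size s by rewrite st.
have tr : [transitive^(size s) 'Alt_('I_n.+3), on [set: 'I_n.+3]%SET | 'P]%g.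
  by apply: ntransitive_weak (Alt_trans _); rewrite card_ord.
have ds : in_tuple s \in dtuple_on (size s) [set: 'I_n.+3]%SET
  by apply/dtuple_onP; split=> [|i]; [exact/tuple_uniqP|rewrite inE].
have dt : Tuple sP \in dtuple_on (size s) [set: 'I_n.+3]%SET
  by apply/dtuple_onP; split=> [|i]; [exact/tuple_uniqP|rewrite inE].
have [p pA /(congr1 val)/= ->] := atransP2 tr ds dt.
by exists p.
Qed.

(* Letter [j] of [w] sends point [j] to point [j + 1], so that [w] sends [0] to
   its length; the prescriptions on one generator are injective because [w] is
   reduced. *)
Lemma reduced_word_Alt m (w : seq ('I_m * bool)) n :
  w != [::] -> reduced w -> (size w <= n.+1)%N ->
  exists s : 'I_m -> {perm 'I_n.+3},
    (forall i, s i \in ('Alt_('I_n.+3))%g) /\ word_eval s w != 1%g.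
Proof.
move=> w0 wred wn.
have a0 : 'I_m * bool by case: w w0 {wred wn}.
(* What is prescribed is the action of the generator: for an inverse letter it must send [j + 1] to
   [j]. *)
pose src j : nat := (j + (nth a0 w j).2)%N.
pose tgt j : nat := (j + ~~ (nth a0 w j).2)%N.
pose J i := [seq j <- iota 0 (size w) | (nth a0 w j).1 == i].
have JP i j : j \in J i -> (j < size w)%N /\ (nth a0 w j).1 = i.
  by rewrite mem_filter mem_iota => /andP[/eqP-> /andP[_ ?]].
have red j : (j.+1 < size w)%N -> (nth a0 w j).1 = (nth a0 w j.+1).1 ->
    (nth a0 w j).2 = (nth a0 w j.+1).2.
  move: wred => /(sortedP a0)/(_ j) h /h + e.
  by rewrite e eqxx /= negbK => /eqP.
have src_lt i j j' : j \in J i -> j' \in J i -> (j < j')%N ->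
    (src j < src j')%N /\ (tgt j < tgt j')%N.
  (* Positions at least two apart keep their order under shifts by at most one. Adjacent positions
     with the same generator carry the same exponent, as [w] is reduced. *)
  move=> /JP[jw ji] /JP[jw' ji']; rewrite leq_eqVlt => /predU1P[e|]; last first.
    rewrite /src /tgt; do 2 case: (_.2) => /=; rewrite ?addn0 ?addn1 => *;
      by split; lia.
  have := red j; rewrite e ji ji' => /(_ jw' erefl) h.
  by rewrite /src /tgt h -e; split; rewrite ltn_add2r.
have inj_lt (f : nat -> nat) i : (forall j j', j \in J i -> j' \in J i ->
    (j < j')%N -> (f j < f j')%N) -> {in J i &, injective f}.
  move=> fl j j' ij ij' e; case: (ltngtP j j') => // h.
    by have := fl _ _ ij ij' h; rewrite e ltnn.
  by have := fl _ _ ij' ij h; rewrite e ltnn.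
have inord_inj (f : nat -> nat) i : {in J i, forall j, (f j <= size w)%N} ->
    {in J i &, injective f} ->
    uniq [seq inord (f j) : 'I_n.+3 | j <- J i].
  move=> fw fI; rewrite map_inj_in_uniq ?filter_uniq ?iota_uniq// => j j' ij ij'.
  move=> /(congr1 val); rewrite /= !inordK; first exact: fI.
    by have := fw _ ij'; lia.
  by have := fw _ ij; lia.
have /choice[s sP] : forall i, exists p : {perm 'I_n.+3},
    p \in ('Alt_('I_n.+3))%g /\
    map p [seq inord (src j) | j <- J i] = [seq inord (tgt j) | j <- J i].
  move=> i; have [|||| p pA e] := @Alt_extend n [seq inord (src j) | j <- J i]
    [seq inord (tgt j) | j <- J i].
  - apply: inord_inj => [j /JP[jw _]|]; first by rewrite /src; case: (_.2); lia.
    by apply: inj_lt => j j' ij ij' h; case: (src_lt i j j').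
  - apply: inord_inj => [j /JP[jw _]|]; first by rewrite /tgt; case: (_.2); lia.
    by apply: inj_lt => j j' ij ij' h; case: (src_lt i j j').
  - by rewrite !size_map.
  - by rewrite size_map size_filter (leq_trans (count_size _ _))// size_iota.
  by exists p.
exists s; split=> [i|]; first by case: (sP i).
have sE j : (j < size w)%N ->
    s (nth a0 w j).1 (inord (src j)) = inord (tgt j).
  move=> jw; have [_] := sP (nth a0 w j).1.
  rewrite -map_comp => /eq_in_map; apply.
  by rewrite mem_filter eqxx mem_iota.
(* Products of permutations apply the left factor first, so prefixes of [w] are followed. *)
have track j : (j <= size w)%N ->
    (word_eval s (take j w) : {perm 'I_n.+3}) (inord 0) = inord j.
  elim: j => [_|j IH jw]; first by rewrite take0 /word_eval big_nil perm1.
  rewrite (take_nth a0)// word_eval_rcons permM IH; last exact: ltnW.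
  have := sE j jw; rewrite /src /tgt; case: (nth a0 w j) => i [] /=.
    by rewrite addn1 addn0 => <-; rewrite permK.
  by rewrite addn0 addn1.
apply/eqP => w1; have := track _ (leqnn _).
rewrite take_size w1 perm1 => /(congr1 val); rewrite /= !inordK//; last by lia.
by move/esym/eqP; rewrite size_eq0; apply/negP.
Qed.

(** * Even permutation matrices *)

Section PermSU.
Variables (R : realType) (n : nat).

(** An odd permutation matrix has determinant -1; it is sent to the default value 1. *)
Definition SU_perm (s : {perm 'I_n}) : SU R n := insubd (1%g : SU R n) (perm_mx s).

Lemma SU_permE s : s \in ('Alt_('I_n))%g -> SU_mx (SU_perm s) = perm_mx s.
Proof.
rewrite Alt_even => s_even; apply: insubdK; apply/mem_set; split.
  apply/unitarymxP; rewrite tr_perm_mx map_perm_mx -perm_mxM mulgV.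
  exact: perm_mx1.
by rewrite det_perm (negbTE s_even) expr0.
Qed.

Lemma SU_perm1 : SU_perm 1%g = 1%g.
Proof. by apply: val_inj; rewrite -[LHS]/(SU_mx _) SU_permE ?group1// perm_mx1. Qed.

Lemma SU_permM : {in ('Alt_('I_n))%g &, {morph SU_perm : s t / (s * t)%g}}.
Proof.
move=> s t sA tA; apply: val_inj; rewrite -[LHS]/(SU_mx _) SU_permE ?groupM//.
by rewrite perm_mxM -!SU_permE.
Qed.

Lemma SU_perm_eq1 s : s \in ('Alt_('I_n))%g -> SU_perm s = 1%g -> s = 1%g.
Proof.
move=> sA /(congr1 (@SU_mx R n)); rewrite SU_permE// => s1.
apply/permP => i; rewrite perm1; apply/eqP.
have /matrixP/(_ i (s i)) := s1; rewrite !mxE eqxx eq_sym.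
by case: (s i == i) => //= /eqP; rewrite mulr0n oner_eq0.
Qed.

End PermSU.

(** * The Hausdorff distance between compact subgroups *)

Section SUprodWords.
Variable R : realType.

Lemma word_eval_nbhs m (k : 'I_m -> SUprod R) w A : nbhs (word_eval k w) A ->
  exists U : 'I_m -> set (SUprod R), (forall i, nbhs (k i) (U i)) /\
    forall h, (forall i, U i (h i)) -> A (word_eval h w).
Proof.
elim: w A => [|[i b] w IH] A.
  rewrite /word_eval big_nil => /nbhs_singleton A1; exists (fun=> setT).
  by split=> [i|h _]; [exact: filterT|rewrite big_nil].
rewrite word_eval_cons => kA.
have [[P Q] /= [Pl Qw] PQA] := @SUprod_mul_continuous R (_, _) _ kA.
have [U [kU UQ]] := IH _ Qw.
have {}Pl : nbhs (k i) [set x | P (if b then (x^-1)%g else x)].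
  by case: b Pl {kA} => //= Pl; exact: (@SUprod_inv_continuous R).
exists (fun j => U j `&` [set x | j = i -> P (if b then (x^-1)%g else x)]).
split=> [j|h hU].
  apply: filterI => //; have [->|ji] := eqVneq j i.
    by apply: filterS Pl => x Px.
  by apply: (@filterE _ _ (nbhs_filter (k j))) => x /eqP; rewrite (negbTE ji).
rewrite word_eval_cons; apply: (PQA (_, _)); split=> /=.
  by have [_] := hU i; apply.
by apply: UQ => j; have [] := hU j.
Qed.

Lemma word_eval_neq1_nbhs m (k : 'I_m -> SUprod R) w : word_eval k w <> 1%g ->
  exists U : 'I_m -> set (SUprod R),
    [/\ forall i, open (U i), forall i, U i (k i) &
        forall h, (forall i, U i (h i)) -> word_eval h w <> 1%g].
Proof.
move=> w1; have : nbhs (word_eval k w) (~` [set 1%g]).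
  apply: open_nbhs_nbhs; split=> //; apply: closed_openC.
  apply: accessible_closed_set1; apply: hausdorff_accessible.
  exact: SUprod_hausdorff.
move=> /word_eval_nbhs[U [kU UA]]; exists (fun i => (U i)°); split.
- by move=> i; exact: open_interior.
- by move=> i; exact: kU.
- by move=> h hU; apply: UA => i; exact: interior_subset.
Qed.

Lemma word_eval_coord m (k : 'I_m -> SUprod R) w n :
  word_eval k w n = word_eval (fun i => k i n) w.
Proof. exact: (@word_eval_morph _ _ _ (fun x : SUprod R => x n) predT). Qed.

Lemma word_eval_val (G : csubgroup R) m (k : 'I_m -> G) w :
  val (word_eval k w) = word_eval (fun i => val (k i) : SUprod R) w.
Proof.
apply: (@word_eval_morph _ _ _ (fun x : G => val x : SUprod R) predT) => //.
Qed.

End SUprodWords.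

(** * The product metric and its Hausdorff distance *)

Section Distance.
Variables (R : realType) (dn : forall n : nat, SU R n.+1 -> SU R n.+1 -> R).
Hypotheses (dn_metric : forall n, metrizes (@dn n))
  (dn_le1 : forall n x y, @dn n x y <= 1).

Local Notation d := (SUprod_dist dn).

Let dn_ge0 n x y : 0 <= @dn n x y.
Proof.
have [[d0 ds dt] _] := dn_metric n.
have := dt x y x; rewrite (ds y x) (proj2 (d0 x x) erefl); lra.
Qed.

Let term (x y : SUprod R) n : R := 2^-1 ^+ n.+1 * @dn n (x n) (y n).

Let term_ge0 x y n : 0 <= term x y n.
Proof. by rewrite mulr_ge0 ?exprn_ge0. Qed.

Let series_nd x y : {homo series (term x y) : m n / (m <= n)%N >-> m <= n}.
Proof.
by apply/nondecreasing_seqP => n; rewrite /series /= big_nat_recr //= lerDl.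
Qed.

(** Terms before [N] vanish, and the others are bounded by a geometric sum from [N] to [n]; the
    [maxn] makes the bound 0 while [n] is at most [N]. *)
Let series_le x y N n : (forall i, (i < N)%N -> x i = y i) ->
  series (term x y) n <= 2^-1 ^+ N - 2^-1 ^+ (maxn N n).
Proof.
move=> xy; elim: n => [|n IH].
  by rewrite /series /= big_geq // maxn0 subrr.
rewrite /series /= big_nat_recr //=.
have [nN|Nn] := ltnP n N.
  have -> : term x y n = 0.
    rewrite /term xy//; have [[d0 _ _] _] := dn_metric n.
    by rewrite (proj2 (d0 _ _) erefl) mulr0.
  by rewrite addr0 (maxn_idPl nN); move: IH; rewrite (maxn_idPl (ltnW nN)).
have tn : term x y n <= 2^-1 ^+ n.+1 by rewrite ler_piMr ?exprn_ge0.
rewrite (maxn_idPr (leqW Nn)); move: IH; rewrite (maxn_idPr Nn) /series /=.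
by move: tn; rewrite exprS; lra.
Qed.

Let series_le1 x y n : series (term x y) n <= 1.
Proof.
apply: le_trans (@series_le x y 0%N n _) _ => //.
by rewrite expr0 gerBl exprn_ge0.
Qed.

Let series_cvg x y : cvgn (series (term x y)).
Proof.
apply: nondecreasing_is_cvgn; first exact: series_nd.
by exists 1 => _ [n _ <-]; exact: series_le1.
Qed.

Lemma SUprod_dist_ge_term x y n : 2^-1 ^+ n.+1 * @dn n (x n) (y n) <= d x y.
Proof.
apply: le_trans (nondecreasing_cvgn_le (@series_nd x y) (@series_cvg x y) n.+1).
by rewrite /series /= big_nat_recr //= lerDr sumr_ge0.
Qed.

Lemma SUprod_dist_ge0 x y : 0 <= d x y.
Proof. by apply: le_trans (SUprod_dist_ge_term x y 0); exact: term_ge0. Qed.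

Lemma SUprod_dist_le x y N : (forall i, (i < N)%N -> x i = y i) ->
  d x y <= 2^-1 ^+ N.
Proof.
move=> xy; apply: limr_le; first exact: series_cvg.
apply: nearW => n; apply: le_trans (series_le _ xy) _.
by rewrite gerBl exprn_ge0.
Qed.

Lemma SUprod_dist_le1 x y : d x y <= 1.
Proof. by rewrite (le_trans (@SUprod_dist_le x y 0 _))// expr0. Qed.

(** A cylinder constrains finitely many coordinates, and the distance in coordinate [N] is at most
    [2^(N+1)] times the total distance. *)
Lemma nbhs_SUprod_dist (x : SUprod R) A : nbhs x A ->
  exists2 e, 0 < e & forall y, d x y < e -> A y.
Proof.
move=> /prod_nbhs_cylinder[N [U [xU UA]]].
suff [e e0 eU] : exists2 e, 0 < e &
    forall y, d x y < e -> forall n, (n < N)%N -> U n (y n).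
  by exists e => // y /eU; exact: UA.
elim: N {UA} => [|N [e e0 eU]]; first by exists 1.
have [_ dno] := dn_metric N.
have [f f0 fU] := (dno _).1 (open_interior (U N)) _ (xU N).
exists (Num.min e (2^-1 ^+ N.+1 * f)).
  by rewrite lt_min e0 mulr_gt0 ?exprn_gt0.
move=> y; rewrite lt_min => /andP[ye yf] n; rewrite ltnS leq_eqVlt => /predU1P[->|].
  apply: interior_subset; apply: fU.
  have := le_lt_trans (SUprod_dist_ge_term x y N) yf.
  by rewrite ltr_pM2l ?exprn_gt0.
exact: eU.
Qed.

(** The bounds 0 and 1 on the distance ensure that the infima and suprema are not default values. *)
Lemma hausdorff_dist_lt (A B : set (SUprod R)) e x :
  B !=set0 -> hausdorff_dist d A B < e -> A x -> exists2 y, B y & d x y < e.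
Proof.
move=> [b Bb] dAB Ax.
have lb a : has_lbound [set d a b | b in B].
  by exists 0 => _ [y _ <-]; exact: SUprod_dist_ge0.
have : inf [set d x b | b in B] < e.
  apply: le_lt_trans dAB; rewrite /hausdorff_dist le_max; apply/orP; left.
  apply: ub_le_sup; last by exists x.
  exists 1 => _ [a _ <-]; apply: le_trans (SUprod_dist_le1 a b).
  by apply: ge_inf; [exact: lb|exists b].
case/inf_lt => [|_ [y By <-] ye]; first by exists (d x b), b.
by exists y.
Qed.

Lemma hausdorff_dist_le (A B : set (SUprod R)) c :
  A !=set0 -> B !=set0 ->
  (forall x, A x -> exists2 y, B y & d x y <= c) ->
  (forall y, B y -> exists2 x, A x & d x y <= c) ->
  hausdorff_dist d A B <= c.
Proof.
move=> [a Aa] [b Bb] AB BA; rewrite /hausdorff_dist ge_max; apply/andP; split.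
  apply: ge_sup; first by exists (inf [set d a b | b in B]), a.
  move=> _ [x /AB[y By xy] <-]; apply: le_trans xy; apply: ge_inf; last by exists y.
  by exists 0 => _ [z _ <-]; exact: SUprod_dist_ge0.
apply: ge_sup; first by exists (inf [set d a b | a in A]), b.
move=> _ [y /BA[x Ax xy] <-]; apply: le_trans xy; apply: ge_inf; last by exists x.
by exists 0 => _ [z _ <-]; exact: SUprod_dist_ge0.
Qed.

Lemma csubgroup_nonempty (G : csubgroup R) : csubgroup_set G !=set0.
Proof.
by have [_ [G1 _]] := set_mem (valP G); exists 1%g; exact: set_mem G1.
Qed.

Lemma open_meets (O : set (SUprod R)) : open O ->
  open [set G : csubgroup_space dn | csubgroup_set G `&` O !=set0].
Proof.
move=> oO; suff : metric_open (fun G H : csubgroup R =>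
    hausdorff_dist d (csubgroup_set G) (csubgroup_set H))
    [set G | csubgroup_set G `&` O !=set0] by [].
move=> G [x [Gx Ox]].
have [e e0 eO] := nbhs_SUprod_dist (open_nbhs_nbhs (conj oO Ox)).
exists e => // H /hausdorff_dist_lt/(_ Gx)[|y Hy /eO Oy]; last by exists y.
exact: csubgroup_nonempty.
Qed.

End Distance.

(** * Splicing even permutations into one coordinate *)

Section Splice.
Variables (R : realType) (N : nat).

(** [dfwith] puts [a] at coordinate [N] without transport along an equality of indices. *)
Definition splice (x : SUprod R) (a : SU R N.+1) : SUprod R :=
  dfwith (fun n => if (n < N)%N then x n else 1%g) N a.

Lemma splice_lt x a n : (n < N)%N -> splice x a n = x n.
Proof. by move=> nN; rewrite /splice dfwithout ?nN// gtn_eqF. Qed.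

Lemma splice_eq x a : splice x a N = a.
Proof. by rewrite /splice dfwithin. Qed.

Lemma splice_gt x a n : (N < n)%N -> splice x a n = 1%g.
Proof.
by move=> nN; rewrite /splice dfwithout ?ltn_eqF// ltnNge (ltnW nN).
Qed.

Lemma splice1 : splice 1%g 1%g = 1%g.
Proof.
apply: functional_extensionality_dep => n.
case: (ltngtP n N) => [nN|nN|->]; first by rewrite splice_lt.
  by rewrite splice_gt.
by rewrite splice_eq.
Qed.

Lemma splice_div x y a b :
  (splice x a / splice y b)%g = splice (x / y)%g (a / b)%g.
Proof.
apply: functional_extensionality_dep => n.
rewrite -[LHS]/((splice x a n / splice y b n)%g).
case: (ltngtP n N) => [nN|nN|->]; first by rewrite !splice_lt.
  by rewrite !splice_gt// divg1.
by rewrite !splice_eq.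
Qed.

Lemma splice_continuous :
  continuous (fun p : SUprod R * SU R N.+1 => splice p.1 p.2).
Proof.
apply: continuous_prod => n p.
case: (ltngtP n N) => [nN|nN|->].
- have -> : (fun q : SUprod R * SU R N.+1 => splice q.1 q.2 n) =
      (fun q => q.1 n) by apply/funext => q /=; rewrite splice_lt.
  apply: (@cvg_comp _ _ _ fst (fun x : SUprod R => x n) _ (nbhs p.1)).
    exact: cvg_fst.
  by move=> U; exact: (@nbhs_proj (fun n => SU R n.+1)).
- have -> : (fun q : SUprod R * SU R N.+1 => splice q.1 q.2 n) = (fun=> 1%g).
    by apply/funext => q /=; rewrite splice_gt.
  exact: cvg_cst.
- have -> : (fun q : SUprod R * SU R N.+1 => splice q.1 q.2 N) = snd.
    by apply/funext => q /=; rewrite splice_eq.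
  exact: cvg_snd.
Qed.

Variable G : csubgroup R.

Let F : set (SU R N.+1) :=
  [set SU_perm R s | s in [set s | s \in ('Alt_('I_N.+1))%g]].
Let GF : set (SUprod R) :=
  [set splice p.1 p.2 | p in csubgroup_set G `*` F].

(** Compact as a continuous image of a compact set times a finite one, and a group because splicing
    commutes with division. *)
Let GF_subproof : GF \in [set G : set (SUprod R) | compact G /\ group_closed [in G]].
Proof.
have [cG [/set_mem G1 Gd]] := set_mem (valP G).
apply/mem_set; split.
  apply: continuous_compact; first exact: continuous_subspaceT splice_continuous.
  apply: compact_setX => //; apply: finite_compact; exact: finite_image.
split.
  apply/mem_set; exists (1%g, 1%g); last exact: splice1.
  by split=> //; exists 1%g; [exact: group1|exact: SU_perm1].
move=> _ _ /set_mem[[x _] [/= Gx [s sA <-]] <-] /set_mem[[y _] [/= Gy [t tA <-]] <-].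
apply/mem_set; exists ((x / y)%g, (SU_perm R s / SU_perm R t)%g); last first.
  by rewrite /= splice_div.
split=> /=; first by apply/set_mem; apply: Gd; exact: mem_set.
exists (s * t^-1)%g; first by rewrite /= groupM ?groupV.
rewrite SU_permM ?groupV//; congr (_ * _)%g.
by apply/eqP; rewrite -mulg_eq1 -SU_permM ?groupV// mulVg SU_perm1.
Qed.

Definition spliced_group : csubgroup R :=
  exist (fun G => G \in [set G : set (SUprod R) | compact G /\ group_closed [in G]])
    _ GF_subproof.

Lemma spliced_groupP x s : csubgroup_set G x -> s \in ('Alt_('I_N.+1))%g ->
  csubgroup_set spliced_group (splice x (SU_perm R s)).
Proof. by move=> Gx sA; exists (x, SU_perm R s) => //; split=> //; exists s. Qed.

Lemma spliced_group_dist (dn : forall n : nat, SU R n.+1 -> SU R n.+1 -> R) :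
  (forall n, metrizes (@dn n)) -> (forall n x y, @dn n x y <= 1) ->
  hausdorff_dist (SUprod_dist dn) (csubgroup_set G) (csubgroup_set spliced_group)
    <= 2^-1 ^+ N.
Proof.
move=> dm d1; apply: hausdorff_dist_le => //; try exact: csubgroup_nonempty.
  move=> x Gx; exists (splice x (SU_perm R 1%g)).
    by apply: spliced_groupP => //; exact: group1.
  by apply: SUprod_dist_le => // n nN; rewrite splice_lt.
move=> _ [[x a] [/= Gx _] <-]; exists x => //.
by apply: SUprod_dist_le => // n nN; rewrite splice_lt.
Qed.

End Splice.

(** * Generic subgroups *)

(** Splicing far out gives a group near [G] with a tuple in the [U i] at which [w] is not 1. By
    continuity of [w] this persists in every group meeting certain smaller open sets, and meeting an
    open set is an open condition. *)
Lemma nowhere_dense_law (R : realType)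
    (dn : forall n : nat, SU R n.+1 -> SU R n.+1 -> R) m (w : seq ('I_m * bool))
    (U : 'I_m -> set (SUprod R)) :
  (forall n, metrizes (@dn n)) -> (forall n x y, @dn n x y <= 1) ->
  w != [::] -> reduced w -> (forall i, open (U i)) ->
  nowhere_dense [set G : csubgroup_space dn |
    (forall i, csubgroup_set G `&` U i !=set0) /\
    forall k : 'I_m -> SUprod R,
      (forall i, csubgroup_set G (k i) /\ U i (k i)) -> word_eval k w = 1%g].
Proof.
move=> dm d1 w0 wred oU; apply: nowhere_dense_avoid => W oW W0.
have [[G WG /choice[x xP]]|nW] := pselect (exists2 G, W G &
    forall i, csubgroup_set G `&` U i !=set0); last first.
  exists W; split=> //; rewrite -subset0 => G [WG [GU _]].
  by apply: nW; exists G.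
have [e e0 eW] : exists2 e, 0 < e & forall H : csubgroup R,
    hausdorff_dist (SUprod_dist dn) (csubgroup_set G) (csubgroup_set H) < e -> W H.
  exact: (oW : metric_open _ W).
have /choice[M MP] : forall i, exists N, forall y : SUprod R,
    (forall n, (n < N)%N -> y n = x i n) -> U i y.
  move=> i; have [_ Ui] := xP i.
  have [N [V [xV VU]]] := prod_nbhs_cylinder (open_nbhs_nbhs (conj (oU i) Ui)).
  exists N => y yx; apply: VU => n nN; rewrite yx//; exact: nbhs_singleton.
have [N0 N0e] : exists N, 2^-1 ^+ N < e.
  have [N _ /(_ N (leqnn N))] := near_infty_natSinv_expn_lt (PosNum e0).
  by exists N; rewrite exprVn -div1r.
have [m0 Mm] : exists m0, forall i, (M i <= m0)%N.
  by exists (\max_i M i) => i; exact: leq_bigmax.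
(* [size w] leaves room for the permutations, [N0] keeps the spliced group within [e] of [G], and
   [m0] keeps the spliced points in the [U i]. *)
pose n := (size w + N0 + m0)%N.
have [|s [sA sw]] := @reduced_word_Alt m w n w0 wred; first by lia.
(* Coordinate [n + 2] lies in [SU(n + 3)], which matches permutations of [n + 3] points. *)
pose H := spliced_group n.+2 G.
have WH : W H.
  apply: eW; apply: le_lt_trans (spliced_group_dist n.+2 G dm d1) _.
  by apply: le_lt_trans N0e; apply: ler_wiXn2l; [lra|lra|rewrite /n; lia].
pose y i := splice (x i) (SU_perm R (s i)).
have Hy i : csubgroup_set H (y i).
  by apply: spliced_groupP; [case: (xP i)|exact: sA].
have Uy i : U i (y i).
  apply: MP => l lM; rewrite /y splice_lt//.
  by have := Mm i; lia.
have yw : word_eval y w <> 1%g.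
  move=> /(congr1 (fun z : SUprod R => z n.+2)); rewrite word_eval_coord.
  have -> : (fun i => y i n.+2) = (fun i => SU_perm R (s i)).
    by apply/funext => i; rewrite /y splice_eq.
  rewrite -(@word_eval_morph m _ _ (@SU_perm R n.+3)
    [in ('Alt_('I_n.+3))%g] s w (SU_perm1 _ _)) //; last 2 first.
  - split=> [|a b aA bA]; first exact: group1.
    by apply: (@groupM _ ('Alt_('I_n.+3))%G a b^-1%g) => //; rewrite groupV.
  - exact: SU_permM.
  move=> /SU_perm_eq1 => h; move/eqP: sw; apply; apply: h.
  by rewrite /word_eval; apply: group_prod => -[i []] _ /=; rewrite ?groupV sA.
have [Q [oO Oy Ow]] := word_eval_neq1_nbhs yw.
have oV : open [set H : csubgroup_space dn |
    forall i, csubgroup_set H `&` (U i `&` Q i) !=set0].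
  rewrite openE => K KV.
  apply: (@filter_forall _ _ (fun i (H : csubgroup_space dn) =>
    csubgroup_set H `&` (U i `&` Q i) !=set0) (nbhs K)) => i.
  apply: open_nbhs_nbhs; split; last exact: KV.
  by apply: open_meets => //; exact: openI.
exists (W `&` [set H : csubgroup_space dn |
    forall i, csubgroup_set H `&` (U i `&` Q i) !=set0]); split.
- exact: openI.
- by exists H; split=> // i; exists (y i).
- by move=> K [].
- rewrite -subset0 => K [[_ /choice[k kP]] [_ KU]].
  apply: (Ow k) => [i|]; first by have [_ []] := kP i.
  by apply: KU => i; have [? []] := kP i.
Qed.

(** * Generic compact subsets of a fixed generic group *)

Section FreeGroup.
Variables (R : realType) (G : csubgroup R) (B : seq nat -> set (SUprod R)).
(** Restricting [lawless] to basic sets makes it a countable family of conditions on [G]. *)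
Hypotheses (bB : countable_base B)
  (lawless : forall m (w : seq ('I_m * bool)) (u : 'I_m -> seq nat),
    w != [::] -> reduced w ->
    (forall i, csubgroup_set G `&` B (u i) !=set0) ->
    exists2 k : 'I_m -> SUprod R,
      (forall i, csubgroup_set G (k i) /\ B (u i) (k i)) & word_eval k w <> 1%g).

Lemma csubgroup_base : countable_base (fun s => [set x : G | B s (val x)]).
Proof. exact: (@initial_base G _ _ _ (@set_val _ (csubgroup_set G)) bB). Qed.

Lemma csubgroup_hausdorff : hausdorff_space G.
Proof.
apply: hausdorff_separated => x y xy.
exists (SUprod R), (@set_val _ (csubgroup_set G)); split.
- exact: SUprod_hausdorff.
- exact: initial_continuous.
- by move=> /val_inj.
Qed.

Lemma lawless_shrink m (w : seq ('I_m * bool)) (V : 'I_m -> set G) :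
  w != [::] -> reduced w ->
  (forall i, open (V i)) -> (forall i, V i !=set0) ->
  exists V' : 'I_m -> set G,
    [/\ forall i, open (V' i), forall i, V' i !=set0,
        forall i, V' i `<=` V i &
        forall k, (forall i, V' i (k i)) -> word_eval k w <> 1%g].
Proof.
move=> w0 wred oV /choice[x Vx].
have [oB' bB'] := csubgroup_base.
have /choice[u uP] : forall i, exists s,
    B s (val (x i)) /\ [set x : G | B s (val x)] `<=` V i.
  move=> i; have [s] := bB' _ _ (open_nbhs_nbhs (conj (oV i) (Vx i))).
  by exists s.
have [|k kP kw] := lawless (u := u) w0 wred.
  by move=> i; exists (val (x i)); split; [exact: set_mem (valP _)|case: (uP i)].
have [Q [oO Ok Ow]] := word_eval_neq1_nbhs kw.
exists (fun i => [set x : G | (B (u i) `&` Q i) (val x)]); split.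
- by move=> i; exists (B (u i) `&` Q i) => //; apply: openI => //; case: bB.
- move=> i; have [Gk Bk] := kP i.
  by exists (exist (fun x => x \in csubgroup_set G) _ (mem_set Gk)).
- by move=> i y [By _]; have [_] := uP i; apply.
- move=> h hO /(congr1 val); rewrite word_eval_val; apply: Ow => i.
  by have [] := hO i.
Qed.

(** When both members of the box are [U], a pair at which [x y^-1] is not 1 consists of two distinct
    points of [U]. *)
Lemma lawless_perfect : perfect_in [set: G].
Proof.
move=> U oU; rewrite setTI => U0.
pose w : seq ('I_2 * bool) := [:: (ord0, false); (ord_max, true)].
have [V [_ V0 VU Vw]] := @lawless_shrink 2 w (fun=> U) isT isT
  (fun=> oU) (fun=> U0).
move: V0 => /choice[k kP].
exists (k ord0), (k ord_max); split.
- exact: VU (kP _).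
- exact: VU (kP _).
- move=> k01; apply: (Vw k kP).
  by rewrite /w !word_eval_cons /= k01 /word_eval big_nil mulg1 mulgV.
Qed.

(** An exceptional [K] has an isolated point or satisfies one of countably many words at distinct
    points. A nonempty perfect compact set has at least continuum many points, and the countable
    base gives the converse bound. *)
Lemma lawless_comeager : comeager [set K : compacts G |
  K #= [set: R] /\ freely_generates K].
Proof.
pose I := {m & seq ('I_m * bool)}.
pose law (l : I) := [set K : compacts G | tagged l != [::] /\ reduced (tagged l) /\
  exists k : 'I_(tag l) -> G, [/\ injective k, forall i, compacts_set K (k i) &
    word_eval k (tagged l) = 1%g]].
have mlaw : meager (\bigcup_l law l).
  apply: meager_bigcup => -[m w].
  have [[w0 wred]|nw] := pselect (w != [::] /\ reduced w).
    apply: sub_meager (@mycielski G m (fun k => word_eval k w = 1%g) _ _ _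
      csubgroup_hausdorff csubgroup_base); first by move=> K [_ [_]].
    by move=> V; exact: lawless_shrink.
  exists (fun=> set0); split=> [n|K [w0 [wred _]]]; last by case: nw.
  by rewrite /nowhere_dense closure0 interior0.
apply: sub_meager (meagerU (meager_not_perfect csubgroup_hausdorff csubgroup_base
  lawless_perfect) mlaw) => K nK.
have [pK|npK] := pselect (perfect_in (compacts_set K)); last by left.
right; apply: contrapT => nlaw; apply: nK.
have [cK K0] := set_mem (valP K).
split; last first.
  move=> m k kI kK w w0 wred kw; apply: nlaw.
  exists (existT (fun m => seq ('I_m * bool)) m w) => //.
  by split=> //; split=> //; exists k.
rewrite (card_eqr (card_real R)) card_eq_le; apply/andP; split.
  exact: countable_base_card_le csubgroup_hausdorff csubgroup_base.
exact: perfect_card_ge csubgroup_hausdorff cK K0 pK.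
Qed.

End FreeGroup.

Theorem theorem5p31 (R : realType)
  (dn : forall n : nat, SU R n.+1 -> SU R n.+1 -> R)
  (dn_metric : forall n, metrizes (dn n))
  (dn_biinvariant : forall n, biinvariant (dn n))
  (dn_le1 : forall n x y, dn n x y <= 1) :
  comeager [set G : csubgroup_space dn |
    comeager [set K : compacts (G : csubgroup R) |
      K #= [set: R] /\ freely_generates K]].
Proof.
have [B bB] := SUprod_base R.
(* A number of variables, a word and a tuple of basic sets; finite functions keep this index type
   countable. *)
pose I := {m & (seq ('I_m * bool) * {ffun 'I_m -> seq nat})%type}.
pose bad (l : I) := [set G : csubgroup_space dn |
  (tagged l).1 != [::] /\ reduced (tagged l).1 /\
  (forall i, csubgroup_set G `&` B ((tagged l).2 i) !=set0) /\
  forall k, (forall i, csubgroup_set G (k i) /\ B ((tagged l).2 i) (k i)) ->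
    word_eval k (tagged l).1 = 1%g].
apply: (@meager_bigcup_countType _ _ bad) => [[m [w u]]|G nG].
  have [[w0 wred]|nw] := pselect (w != [::] /\ reduced w).
    have := @nowhere_dense_law R dn m w (fun i => B (u i)) dn_metric dn_le1 w0 wred.
    move=> /(_ (fun i => proj1 bB _)); congr nowhere_dense.
    by apply/seteqP; split=> G /=; rewrite /bad /=; tauto.
  suff -> : bad (existT _ m (w, u)) = set0.
    by rewrite /nowhere_dense closure0 interior0.
  by rewrite -subset0 => G [w0 [wred _]]; apply: nw.
(* A group outside every bad set satisfies [lawless], so its generic compact subsets are as
   required. *)
apply: contrapT => nbad; apply: nG; apply: (lawless_comeager bB) => m w u w0 wred Gu.
apply: contrapT => nk; apply: nbad.
exists (existT _ m (w, finfun u)) => //; split=> //; split=> //; split=> /=.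
  by move=> i; rewrite ffunE.
move=> k kP; apply: contrapT => kw; apply: nk; exists k => // i.
by have := kP i; rewrite ffunE.
Qed.
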